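(* Let $k\ge 2$ be any integer, and let $\mathcal{F}_{1,k}$ be the family of all graphs $G$ with $e(G)\equiv 1 \pmod k$. For every $p\ge 2k-1$ if $k$ is odd, and every $p\ge 4k-1$ if $k$ is even, $f(n,K_p|\mathcal{F}_{1,k})=(1+o(1))\,\mathrm{ex}(n,K_{\lceil p/2\rceil})$ as $n\to\infty$.
   Context: $e(G)$ is the number of edges of $G$. $\mathrm{ex}(n,F)$ is the Turán number: the maximum number of edges in a graph of order $n$ containing no subgraph isomorphic to $F$. In an edge coloring of $K_n$ (not necessarily proper), for a copy $G'\subseteq K_n$ of a graph $G$, a color class of $G'$ is the graph (without isolated vertices) formed by all edges of $G'$ having a given color that occurs in $G'$. For a family $\mathcal{F}$ of graphs (closed under isomorphism) with $K_2\in\mathcal{F}$, and $n\ge |G|$, $f(n,G|\mathcal{F})$ is the smallest integer $m$ such that in every edge coloring of $K_n$ using at least $m$ colors there exists a copy of $G$ in which all color classes are members of $\mathcal{F}$. *)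

(* Defs.v *)
From HB Require Import structures.
From mathcomp Require Import all_boot.
From mathcomp Require Import boolp.

Set Implicit Arguments.
Unset Strict Implicit.
Unset Printing Implicit Defensive.

Local Open Scope nat_scope.

Definition pairs (V : finType) : {set {set V}} := [set e : {set V} | #|e| == 2].

Record sgraph (V : finType) := SGraph {
  edges : {set {set V}};
  edges_pairs : edges \subset pairs V
}.

HB.instance Definition _ (V : finType) := [isSub for @edges V].
HB.instance Definition _ (V : finType) := [Finite of sgraph V by <:].

Definition nb_edges (V : finType) (G : sgraph V) : nat := #|edges G|.

Definition complete_graph (n : nat) : sgraph 'I_n := SGraph (subxx (pairs 'I_n)).

Definition isomorphic (V W : finType) (G : sgraph V) (H : sgraph W) : Prop :=
  exists2 f : V -> W, bijective f
    & forall e : {set V}, (f @: e \in edges H) = (e \in edges G).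

(* [H] has a (not necessarily induced) subgraph isomorphic to [G]. *)
Definition contains (V W : finType) (H : sgraph W) (G : sgraph V) : bool :=
  [exists f : {ffun V -> W},
    injectiveb f && [forall e in edges G, f @: e \in edges H]].

Definition turan_number (n : nat) (V : finType) (F : sgraph V) : nat :=
  \max_(H : sgraph 'I_n | ~~ contains H F) nb_edges H.

Record graph_family := GraphFamily {
  family_mem :> forall V : finType, sgraph V -> Prop;
  family_iso : forall (V W : finType) (G : sgraph V) (H : sgraph W),
    isomorphic G H -> family_mem G -> family_mem H;
  family_K2 : family_mem (complete_graph 2)
}.

Lemma spanned_subproof (V : finType) (E : {set {set V}}) :
  E \subset pairs V ->
  [set e : {set {x : V | x \in cover E}} | val @: e \in E] \subset pairs _.
Proof.
move=> /subsetP sE; apply/subsetP => e; rewrite inE => /sE.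
by rewrite !inE card_imset //; exact: val_inj.
Qed.

(* The graph without isolated vertices whose edge set is [E]: its vertices are
   those covered by [E]. *)
Definition spanned (V : finType) (E : {set {set V}}) (sE : E \subset pairs V) :
  sgraph {x : V | x \in cover E} := SGraph (spanned_subproof sE).

Definition copy_edges (V W : finType) (G : sgraph V) (phi : V -> W) :
  {set {set W}} := [set phi @: e | e : {set V} in edges G].

Definition class_edges (V W : finType) (G : sgraph V) (phi : V -> W)
    (C : finType) (c : {set W} -> C) (i : C) : {set {set W}} :=
  [set e in copy_edges G phi | c e == i].

Lemma class_edges_pairs (V W : finType) (G : sgraph V) (phi : V -> W)
    (C : finType) (c : {set W} -> C) (i : C) :
  injective phi -> class_edges G phi c i \subset pairs W.
Proof.
move=> phi_inj; apply/subsetP => e; rewrite inE => /andP[/imsetP[e' e'G ->] _].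
by move/subsetP: (edges_pairs G) => /(_ e' e'G); rewrite !inE card_imset.
Qed.

Definition color_class (V W : finType) (G : sgraph V) (phi : V -> W)
    (phi_inj : injective phi) (C : finType) (c : {set W} -> C) (i : C) :
    sgraph {x : W | x \in cover (class_edges G phi c i)} :=
  spanned (class_edges_pairs G c i phi_inj).

(* An edge coloring of [K_n] is a map on all sets of vertices, of which only the
   values on [pairs 'I_n] are ever used. *)
Definition nb_colors (n : nat) (C : finType) (c : {set 'I_n} -> C) : nat :=
  #|c @: pairs 'I_n|.

Definition forces (n : nat) (V : finType) (G : sgraph V) (F : graph_family)
    (m : nat) : Prop :=
  forall (C : finType) (c : {set 'I_n} -> C), m <= nb_colors c ->
  exists (phi : V -> 'I_n) (phi_inj : injective phi),
    forall i : C, i \in c @: copy_edges G phi ->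
      F _ (color_class G phi_inj c i).

Lemma forces_exists (n : nat) (V : finType) (G : sgraph V) (F : graph_family) :
  exists m, `[< forces n G F m >].
Proof.
exists #|pairs 'I_n|.+1; apply/asboolP => C c.
by rewrite ltnNge leq_imset_card.
Qed.

(* Meaningful for [n >= #|V|]; below that it is the junk value 'C(n, 2) + 1. *)
Definition f_number (n : nat) (V : finType) (G : sgraph V) (F : graph_family) : nat :=
  ex_minn (forces_exists n G F).

Definition mod1_mem (k : nat) (V : finType) (G : sgraph V) : Prop :=
  nb_edges G = 1 %[mod k].

Lemma mod1_iso (k : nat) (V W : finType) (G : sgraph V) (H : sgraph W) :
  isomorphic G H -> mod1_mem k G -> mod1_mem k H.
Proof.
move=> [g [h gK hK] gE]; rewrite /mod1_mem => <-; congr (_ %% _).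
rewrite /nb_edges -(card_imset _ (imset_inj (can_inj gK))).
apply: eq_card => e; apply/idP/imsetP => [eH|[e' e'G ->]]; last by rewrite gE.
have ge : e = g @: (h @: e).
  by rewrite -imset_comp (eq_imset _ hK) imset_id.
by exists (h @: e) => //; rewrite -gE -ge.
Qed.

Lemma mod1_K2 (k : nat) : mod1_mem k (complete_graph 2).
Proof.
rewrite /mod1_mem /nb_edges /=; congr (_ %% _).
by rewrite /pairs card_draws card_ord.
Qed.

Definition family_mod1 (k : nat) : graph_family :=
  GraphFamily (@mod1_iso k) (mod1_K2 k).

(* Main.v *)
Require Import Defs.
From mathcomp Require Import all_boot all_order all_algebra.
From mathcomp Require Import all_classical all_reals all_analysis.
From mathcomp Require Import fintype finset zify ring lra.

(** Let [q = uphalf p] and [r = q - 1]. Both the colouring number and the Turan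
number are squeezed around the edge density [1 - 1/r]: each of them, multiplied
by [2 r] and divided by [n ^ 2], tends to [r - 1] ([turan_density_cvg]), so
their ratio tends to [1].

Lower bound. Split the vertices into [r] residue classes. The complete
[r]-partite graph contains no [K_q], which bounds the Turan number
([turan_lower]). For the colouring number, give every edge between two classes
a colour of its own, and colour an edge inside a class by its largest vertex.
As [p > 2 r], a copy of [K_p] has three vertices in one class; if [x < y < z]
are the three smallest of them, the colour of [z] is borne by exactly two edges,
[xz] and [yz], and [2] is not [1] modulo [k] ([f_number_lower]).

Upper bound. Keep one edge of each colour. If there are more than
[(1 - 1/r + 1/M) n ^ 2 / 2] colours and [n] is large, the Erdos-Stone theorem
([erdos_stone_edges]) gives a complete [q]-partite graph with parts of a given
size whose edges all have different colours. For the Turan number, parts of size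
one are enough ([turan_upper]). For the colouring number, Ramsey's theorem
leaves two cases ([monochromatic_or_matchings]).

- Some part contains a large clique of a single colour. The hypothesis on [k]
  and [p] provides a period [d <= q] ([d = k] for odd [k], [d = 2 k] for even
  [k]) with [binomial (2 + m d) 2] congruent to [1] modulo [k] for all [m]
  ([bin2_period]). Write [p - 2 = m d + s] with [s < d <= q]; take [2 + m d]
  vertices of the monochromatic clique and one vertex from [s] other parts.
  The edges inside the clique form one class, of size [1] modulo [k], and every
  other class is a single edge ([extend_monochromatic]).
- Every part contains a large matching, all these matching edges having
  different colours. Choosing one matching edge per part with some care gives a
  clique on [2 q >= p] vertices whose edges all have different colours
  ([rainbow_of_matchings], [avoiding_choice]). *)

Set Implicit Arguments.
Unset Strict Implicit.
Unset Printing Implicit Defensive.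

Local Open Scope nat_scope.

(** * Choosing subsets and pairs *)

Lemma exists_subset_card (T : finType) (A : {set T}) t :
  t <= #|A| -> exists2 B : {set T}, B \subset A & #|B| = t.
Proof.
case/card_geqP => s [s_uniq <- sA]; exists [set x in s].
  by apply/subsetP => x; rewrite inE => /sA.
by rewrite cardsE; apply/card_uniqP.
Qed.

Lemma pigeonhole (T U : finType) (X : {set T}) (F : {set U}) (h : T -> U) R :
    (forall x, x \in X -> h x \in F) -> #|F| * R < #|X| ->
  exists2 i, i \in F & R < #|[set x in X | h x == i]|.
Proof.
move=> hF ltX; case: (boolP [exists i in F, R < #|[set x in X | h x == i]|]).
  by case/exists_inP => i; exists i.
rewrite negb_exists_in => /forall_inP small; move: ltX.
rewrite ltnNge -sum1_card (partition_big h (mem F)) //=.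
case/negP; rewrite -sum_nat_const; apply: leq_sum => i /small.
rewrite -leqNgt; apply: leq_trans; rewrite -sum1_card; apply: eq_leq.
by apply: eq_bigl => x; rewrite inE.
Qed.

Lemma card_bigcup_le (I T : finType) (F : I -> {set T}) :
  #|\bigcup_i F i| <= \sum_i #|F i|.
Proof.
elim/big_rec2: _ => [|i n B _ le]; first by rewrite cards0.
by apply: leq_trans (leq_card_setU _ _) _; rewrite leq_add2l.
Qed.

Lemma in_pairs2 (V : finType) (x y : V) : ([set x; y] \in pairs V) = (x != y).
Proof. by rewrite inE cards2 eqSS; case: (x != y). Qed.

Lemma pairsP (V : finType) (e : {set V}) :
  reflect (exists x y, x != y /\ e = [set x; y]) (e \in pairs V).
Proof.
by rewrite inE; exact: cards2P.
Qed.

(** * Ramsey's theorem for a bounded palette *)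

Definition monochromatic (V C : finType) (c : {set V} -> C) (A : {set V}) i :=
  forall e, e \in pairs V -> e \subset A -> c e = i.

(** Multicolour Ramsey, by induction on the total [w] of the targets [g i]:
among the edges at a vertex [x] some colour [i] is very frequent, and inside the
corresponding neighbourhood the target of [i] may be lowered by one, since [x]
can be put back in. The bound depends only on the size [s] of the palette and on
[w], not on the type of colours: the colourings to which it is applied have
unboundedly many colours. *)
Lemma ramsey_weighted s w :
  exists R, forall (V C : finType) (c : {set V} -> C) (X : {set V})
    (F : {set C}) (g : C -> nat),
    #|F| <= s -> \sum_(i in F) g i <= w ->
    (forall e, e \in pairs V -> e \subset X -> c e \in F) -> R <= #|X| ->
  exists i (A : {set V}),
    [/\ i \in F, A \subset X, g i <= #|A| & monochromatic c A i].
Proof.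
have mono0 (V C : finType) (c : {set V} -> C) i : monochromatic c set0 i.
  by move=> e /pairsP[x [y [_ ->]]] /subsetP/(_ x); rewrite !inE eqxx => /(_ isT).
elim: w => [|w [R IH]].
  exists 2 => V C c X F g _ g0 cF /card_gt1P[x [y [xX yX xy]]].
  have iF : c [set x; y] \in F.
    by apply: cF; rewrite ?in_pairs2 // subUset !sub1set xX.
  exists (c [set x; y]), set0; split; rewrite ?sub0set //.
  rewrite cards0; apply: leq_trans g0.
  by rewrite (bigD1 (c [set x; y])) //= leq_addr.
exists (s * R + 2) => V C c X F g Fs gw cF RX.
have /card_gt0P[x xX] : 0 < #|X| by apply: leq_trans RX; rewrite addn2.
have cxF y : y \in X :\ x -> c [set x; y] \in F.
  rewrite !inE => /andP[yx yX]; apply: cF; first by rewrite in_pairs2 eq_sym.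
  by rewrite subUset !sub1set xX.
case: (@pigeonhole _ _ (X :\ x) F (fun y => c [set x; y]) R) => //.
  have : #|F| * R <= s * R by rewrite leq_mul2r Fs orbT.
  by move: RX; rewrite (cardsD1 x) xX; lia.
move=> i iF; set Y := [set _ in _ | _] => RY.
have YX : Y \subset X.
  by apply/subsetP => y; rewrite !inE => /andP[/andP[]].
have [gi0|gi_gt0] := posnP (g i).
  by exists i, set0; split; rewrite ?sub0set ?gi0.
pose g' j := if j == i then (g i).-1 else g j.
have g'w : \sum_(j in F) g' j <= w.
  move: gw; rewrite (bigD1 i) //= [X in _ -> X <= _](bigD1 i) //= {1}/g' eqxx.
  rewrite [in X in _ -> X](eq_bigr g); first by lia.
  by rewrite /g' => j /andP[_ /negPf->].
have cYF e : e \in pairs V -> e \subset Y -> c e \in F.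
  by move=> eP eY; apply: cF => //; apply: subset_trans YX.
have [j [A [jF AY gA monoA]]] := IH V C c Y F g' Fs g'w cYF (ltnW RY).
have [ji|ji] := eqVneq j i; last first.
  exists j, A; split=> //; first exact: subset_trans YX.
  by move: gA; rewrite /g' (negPf ji).
subst j; exists i, (x |: A); split=> //.
- by rewrite subUset sub1set xX (subset_trans AY).
- move: gA; rewrite cardsU1 /g' eqxx.
  have -> : x \notin A by apply/negP => /(subsetP AY); rewrite !inE eqxx.
  by rewrite add1n; lia.
have cxA y : y \in A -> c [set x; y] = i.
  by move/(subsetP AY); rewrite !inE => /andP[_ /eqP].
move=> e /pairsP[y [z [yz ->]]]; rewrite subUset !sub1set !inE.
case/andP=> /predU1P[yx|yA] /predU1P[zx|zA].
- by case/eqP: yz; rewrite yx zx.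
- by rewrite yx cxA.
- by rewrite zx setUC cxA.
- by apply: monoA; rewrite ?in_pairs2 // subUset !sub1set yA.
Qed.

Lemma ramsey s a :
  exists R, forall (V C : finType) (c : {set V} -> C) (X : {set V})
    (F : {set C}),
    #|F| <= s ->
    (forall e, e \in pairs V -> e \subset X -> c e \in F) -> R <= #|X| ->
  exists i (A : {set V}), [/\ A \subset X, #|A| = a & monochromatic c A i].
Proof.
have [R HR] := ramsey_weighted s (s * a); exists R => V C c X F Fs cF RX.
have [|i [A [_ AX aA monoA]]] := HR V C c X F (fun=> a) Fs _ cF RX.
  by rewrite sum_nat_const leq_mul2r Fs orbT.
have [B BA Ba] := exists_subset_card aA; exists i, B; split=> //.
  exact: subset_trans AX.
by move=> e eP eB; apply: monoA => //; apply: subset_trans BA.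
Qed.

(** * The Erdos-Stone theorem *)

(** Degree conditions are expressed through non-neighbours ([v] itself counts as
one when [e] is irreflexive): [deg v >= (1 - 1/r + eps) #|A|] then becomes
[r * nonnbr e A v <= (1 - eps') #|A|], which makes sense in [nat] and for
[r = 0]. *)
Definition nonnbr (V : finType) (e : rel V) (A : {set V}) (v : V) : nat :=
  #|[set w in A | ~~ e v w]|.

(** A complete [q]-partite subgraph with parts of size [t] inside [A]. The parts
are indexed by [nat] so that a further part can be appended without a cast
between ordinal types. *)
Definition blowup (V : finType) (e : rel V) (A : {set V}) (q t : nat)
    (P : nat -> {set V}) : Prop :=
  (forall i, i < q -> P i \subset A /\ #|P i| = t) /\
  (forall i j x y, i < q -> j < q -> i != j -> x \in P i -> y \in P j -> e x y).

Lemma nonnbrE (V : finType) (e : rel V) (A : {set V}) v :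
  nonnbr e A v = \sum_(w in A) ~~ e v w.
Proof.
rewrite /nonnbr -sum1_card big_mkcond [RHS]big_mkcond /=.
by apply: eq_bigr => w _; rewrite inE; case: (w \in A); case: (e v w).
Qed.

(** The minimum degree form of the Erdos-Stone theorem, by induction on [r].
Take a complete [r.+1]-partite graph with parts of size [T = 2 M.+1 t]. Counting
non-adjacent pairs between [A] and these parts shows that a fixed proportion of
the vertices of [A] have at least [t] neighbours in each part. Many of them have
the same neighbours in the union of the parts; [t] of them form the new part,
and the old parts are cut down to the common neighbours. *)
Lemma blowup_of_nonnbr r M t :
  0 < t -> exists N, forall (V : finType) (e : rel V) (A : {set V}),
    symmetric e ->
    (forall v, v \in A -> M.+1 * (r * nonnbr e A v) <= M * #|A|) ->
    N <= #|A| -> exists P, blowup e A r.+1 t P.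
Proof.
elim: r t => [|r IH] t t_gt0.
  exists t => V e A _ _ /exists_subset_card[B BA Bt].
  by exists (fun=> B); split=> // -[|i] [|j].
pose T := 2 * M.+1 * t.
have [|N HN] := IH T; first by rewrite !muln_gt0.
exists (maxn N ((2 * M).+1 * (2 ^ (r.+1 * T) * t)).+1) => V e A e_sym deg.
rewrite geq_max => /andP[NA bigA].
have [v vA|//|P [PA Pe]] := HN V e A e_sym.
  by apply: leq_trans (deg v vA); rewrite leq_mul2l leq_mul2r leqnSn !orbT.
pose bad := [set w in A | [exists i : 'I_r.+1, #|[set v in P i | e w v]| < t]].
have card_bad : (2 * M).+1 * #|bad| <= 2 * M * #|A|.
  (* [total] counts the non-adjacent pairs between [A] and the parts [P i]. *)
  pose total := \sum_(w in A) \sum_(i < r.+1) nonnbr e (P i) w.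
  have total_ge : (T - t) * #|bad| <= total.
    rewrite mulnC -sum_nat_const /total.
    apply: leq_trans (_ : \sum_(w in bad) \sum_(i < r.+1) nonnbr e (P i) w <= _).
      apply: leq_sum => w; rewrite inE => /andP[_ /existsP[i lt_i]].
      rewrite (bigD1 i) //= (leq_trans _ (leq_addr _ _)) // /nonnbr.
      have <- : #|P i| = T by apply: (PA i _).2.
      rewrite leq_subLR -(cardsID [set v | e w v] (P i)).
      rewrite !setIdE; apply: leq_add; last first.
        by apply/subset_leq_card/subsetP => v; rewrite !inE andbC.
      apply: leq_trans (ltnW lt_i); apply/subset_leq_card/subsetP => v.
      by rewrite !inE.
    rewrite [leqRHS](bigID (mem bad)) /= -[leqLHS]addn0 leq_add //.
    apply: eq_leq; apply: eq_bigl => w; rewrite !inE.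
    by case: (w \in A).
  have total_le : M.+1 * total <= T * (M * #|A|).
    rewrite -(leq_pmul2l (ltn0Sn r)) /total exchange_big /=.
    have swap (i : 'I_r.+1) : \sum_(w in A) nonnbr e (P i) w
        = \sum_(v in P i) nonnbr e A v.
      under eq_bigr do rewrite nonnbrE.
      rewrite exchange_big /=; apply: eq_bigr => v _; rewrite nonnbrE.
      by apply: eq_bigr => w _; rewrite e_sym.
    under eq_bigr do rewrite swap.
    rewrite mulnCA !big_distrr /=.
    rewrite -[r.+1 in leqRHS]card_ord -sum_nat_const; apply: leq_sum => i _.
    have [PiA PiT] := PA i (ltn_ord i).
    rewrite !big_distrr /= -PiT -sum_nat_const; apply: leq_sum => v vP.
    by rewrite deg // (subsetP PiA).
  have {total_ge total_le} : M.+1 * ((T - t) * #|bad|) <= T * (M * #|A|).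
    by apply: leq_trans total_le; rewrite leq_mul2l total_ge orbT.
  have -> : T - t = (2 * M).+1 * t by rewrite /T; lia.
  rewrite /T; have -> : M.+1 * ((2 * M).+1 * t * #|bad|)
      = (M.+1 * t) * ((2 * M).+1 * #|bad|) by lia.
  have -> : 2 * M.+1 * t * (M * #|A|) = (M.+1 * t) * (2 * M * #|A|) by lia.
  by rewrite leq_pmul2l // muln_gt0.
pose good := A :\: bad.
have good_gt : 2 ^ (r.+1 * T) * t < #|good|.
  have badA : bad \subset A by apply/subsetP => w; rewrite inE => /andP[].
  have : #|good| + #|bad| = #|A|.
    by rewrite /good cardsD (setIidPr badA) subnK // subset_leq_card.
  move: bigA card_bad; move: (_ * t) #|good| #|bad| #|A| => x y z a.
  move=> bigA bad_le sum_a.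
  rewrite -(ltn_pmul2l (ltn0Sn (2 * M))); lia.
pose B := \bigcup_(i < r.+1) P i.
have card_B : #|B| <= r.+1 * T.
  rewrite /B -[r.+1 in leqRHS]card_ord -sum_nat_const.
  apply: leq_trans (card_bigcup_le _) _; apply: leq_sum => i _.
  by rewrite (PA i _).2.
pose h w := [set v in B | e w v].
have [w wgood||S _ fibre] := @pigeonhole _ _ good (powerset B) h t.
- by rewrite inE; apply/subsetP => v; rewrite inE => /andP[].
- rewrite card_powerset; apply: leq_ltn_trans good_gt.
  by rewrite leq_mul2r leq_pexp2l ?orbT.
have [W Wfibre Wt] := exists_subset_card (ltnW fibre).
have W_good w : w \in W -> [/\ w \in A, w \notin bad & h w = S].
  by move/(subsetP Wfibre); rewrite !inE => /andP[/andP[/negPf-> ->] /eqP->].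
have /card_gt0P[w0 w0W] : 0 < #|W| by rewrite Wt.
have [w0A w0bad w0S] := W_good _ w0W.
have PS_ge i : i < r.+1 -> t <= #|P i :&: S|.
  move=> ir; move: w0bad; rewrite inE w0A /= negb_exists.
  move/forallP/(_ (Ordinal ir)); rewrite -leqNgt /= => /leq_trans; apply.
  apply/subset_leq_card/subsetP => v; rewrite !inE => /andP[vP wv].
  rewrite vP -w0S inE wv andbT; apply/bigcupP.
  by exists (Ordinal ir).
pose Q i := odflt set0 [pick D : {set V} | (D \subset P i :&: S) && (#|D| == t)].
have QP i : i < r.+1 -> Q i \subset P i :&: S /\ #|Q i| = t.
  move=> ir; rewrite /Q; case: pickP => [D /andP[? /eqP]//|/=].
  have [D DP Dt] := exists_subset_card (PS_ge i ir).
  by move/(_ D); rewrite DP Dt eqxx.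
have WQ w i v : i < r.+1 -> w \in W -> v \in Q i -> e w v.
  move=> ir /W_good[_ _ wS] /(subsetP (QP i ir).1).
  by rewrite inE -wS inE => /and3P[].
have lt_r i : i < r.+2 -> i != r.+1 -> i < r.+1 by lia.
exists (fun i => if i == r.+1 then W else Q i); split=> [i /lt_r ir|i j x y].
  case: eqP ir => [_ _|_ /(_ isT) ir].
    by split=> //; apply/subsetP => w /W_good[].
  have [QPi Qt] := QP i ir; split=> //; apply: subset_trans (PA i ir).1.
  by apply: subset_trans QPi _; apply: subsetIl.
move=> /lt_r + /lt_r +.
case: (eqVneq i r.+1) => [->|_ /(_ isT) ir].
  case: (eqVneq j r.+1) => [->|_ _ /(_ isT) jr] //.
  by move=> _ xW yQ; apply: WQ yQ.
case: (eqVneq j r.+1) => [_ _|_ /(_ isT) jr].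
  by move=> _ xQ yW; rewrite e_sym; apply: WQ xQ.
move=> ij /(subsetP (QP i ir).1); rewrite inE => /andP[xP _].
move=> /(subsetP (QP j jr).1); rewrite inE => /andP[yP _].
exact: (Pe i j).
Qed.

(** From average to minimum degree: delete a vertex with too many non-neighbours
as long as there is one. Deleting [v] lowers the sum by twice [nonnbr e A v],
except that the pair [(v, v)] is lost only once; the term [#|A|] makes up for
this. So the hypothesis is preserved, and it forces [N <= #|A|] when the process
stops. *)
Lemma large_subset_few_nonnbr r M N (V : finType) (e : rel V) (A : {set V}) :
    symmetric e ->
    M.+1 * (r * (\sum_(v in A) nonnbr e A v + #|A|) + N ^ 2) <= M * #|A| ^ 2 ->
  exists2 B : {set V}, N <= #|B| &
    forall v, v \in B -> M.+1 * (r * nonnbr e B v) <= M * #|B|.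
Proof.
move=> e_sym; elim: {A}_.+1 {-2}A (ltnSn #|A|) => // m IH A.
rewrite ltnS => Am ineq.
case: (boolP [forall v in A, M.+1 * (r * nonnbr e A v) <= M * #|A|]).
  move/forall_inP => fewA; exists A => //.
  rewrite -(leq_sqr N) -(leq_pmul2l (ltn0Sn M)); nia.
rewrite negb_forall_in => /exists_inP[v vA]; rewrite -ltnNge => many.
have cardA : #|A| = #|A :\ v|.+1 by rewrite (cardsD1 v) vA.
apply: (IH (A :\ v)); first by rewrite -cardA.
have sum_drop : \sum_(w in A) nonnbr e A w + ~~ e v v =
    \sum_(w in A :\ v) nonnbr e (A :\ v) w + 2 * nonnbr e A v.
  rewrite (big_setD1 v) //=.
  have step w : w \in A :\ v ->
      nonnbr e A w = nonnbr e (A :\ v) w + ~~ e v w.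
    by move=> _; rewrite !nonnbrE (big_setD1 v) //= addnC e_sym.
  rewrite (eq_bigr _ step) big_split /= [nonnbr e A v]nonnbrE (big_setD1 v) //=.
  lia.
have : \sum_(w in A :\ v) nonnbr e (A :\ v) w + 2 * nonnbr e A v <=
    (\sum_(w in A) nonnbr e A w).+1.
  by rewrite -sum_drop; case: (e v v); lia.
move: many ineq; rewrite cardA.
move: (\sum_(w in A) nonnbr e A w) (\sum_(w in A :\ v) _) => x y.
move: (nonnbr e A v) #|A :\ v| (N ^ 2) => z a K many ineq le_xy.
have : M.+1 * (r * (y + 2 * z)) <= M.+1 * (r * x.+1).
  by rewrite !leq_mul2l le_xy !orbT.
move: many ineq; rewrite -![_ ^ 2]mulnn; nia.
Qed.

Lemma erdos_stone r M t :
  0 < t -> exists K, forall (V : finType) (e : rel V),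
    symmetric e ->
    M.+1 * (r * (\sum_(v : V) nonnbr e [set: V] v + #|V|) + K) <= M * #|V| ^ 2 ->
    exists P, blowup e [set: V] r.+1 t P.
Proof.
move=> /(blowup_of_nonnbr r M)[N HN]; exists (N ^ 2) => V e e_sym ineq.
have [|B NB few] := @large_subset_few_nonnbr r M N V e [set: V] e_sym.
  by rewrite cardsT (eq_bigl predT) // => v; rewrite inE.
have [P [PB Pe]] := HN V e B e_sym few NB; exists P; split=> // i ir.
by rewrite subsetT (PB i ir).2.
Qed.

(** * Graphs as sets of pairs *)

Definition adj (V : finType) (E : {set {set V}}) : rel V :=
  fun x y => [set x; y] \in E.

Lemma adj_sym (V : finType) (E : {set {set V}}) : symmetric (adj E).
Proof. by move=> x y; rewrite /adj setUC. Qed.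

Lemma card_adj (V : finType) (E : {set {set V}}) v : E \subset pairs V ->
  #|[set w | adj E v w]| = #|[set e in E | v \in e]|.
Proof.
move=> /subsetP EP.
have neq w : [set v; w] \in E -> v != w by move/EP; rewrite in_pairs2.
rewrite -(card_in_imset (f := fun w => [set v; w])) => [|w w']; last first.
  rewrite !inE => /neq vw /neq vw' /setP/(_ w').
  by rewrite !inE eqxx orbT eq_sym (negPf vw') /= => /eqP.
apply: eq_card => e; apply/imsetP/idP => [[w + ->]|].
  by rewrite !inE eqxx /= andbT.
rewrite inE => /andP[eE ve]; have /pairsP[x [y [xy e_xy]]] := EP _ eE.
subst e; move: ve; rewrite !inE => /orP[/eqP vx|/eqP vy]; subst v.
  by exists y; rewrite ?inE.
by exists x; rewrite ?inE /adj 1?setUC.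
Qed.

Lemma sum_nonnbr_adj (V : finType) (E : {set {set V}}) : E \subset pairs V ->
  \sum_v nonnbr (adj E) [set: V] v + 2 * #|E| = #|V| ^ 2.
Proof.
move=> EP; have -> : 2 * #|E| = \sum_v #|[set w | adj E v w]|.
  under eq_bigr do rewrite (card_adj _ EP) -sum1_card.
  rewrite mulnC -sum_nat_const.
  under [RHS]eq_bigr do under eq_bigl do rewrite inE.
  rewrite (exchange_big_dep (mem E)) /=; last by move=> v e _ /andP[].
  apply: eq_bigr => e eE; rewrite sum1dep_card.
  have /(subsetP EP) := eE; rewrite inE => /eqP {1}<-.
  by apply: eq_card => v; rewrite inE eE.
rewrite -big_split /= -mulnn -sum_nat_const; apply: eq_bigr => v _.
rewrite addnC -[#|V|]cardsT -(cardsID [set w | adj E v w] setT); congr (_ + _).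
  by apply: eq_card => w; rewrite !inE.
by apply: eq_card => w; rewrite !inE andbT.
Qed.

Lemma erdos_stone_edges r M t :
  0 < t -> exists K, forall (V : finType) (E : {set {set V}}),
    E \subset pairs V ->
    M.+1 * (r * (#|V| ^ 2 + #|V|) + K) <= M * #|V| ^ 2 + M.+1 * (2 * r * #|E|) ->
    exists P, blowup (adj E) [set: V] r.+1 t P.
Proof.
move=> /(erdos_stone r M)[K HK]; exists K => V E EP ineq.
apply: HK (adj_sym E) _; move: ineq; rewrite -(sum_nonnbr_adj EP).
by move: (\sum_v _) => s; lia.
Qed.

Lemma blowup_adj_neq (V : finType) (E : {set {set V}}) A q t P i j x y :
    E \subset pairs V -> blowup (adj E) A q t P -> i < q -> j < q -> i != j ->
  x \in P i -> y \in P j -> x != y /\ [set x; y] \in E.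
Proof.
move=> /subsetP EP [_ Pe] iq jq ij xP yP.
have xyE := Pe i j x y iq jq ij xP yP.
by split=> //; move/EP: xyE; rewrite in_pairs2.
Qed.

(** * Cliques with good colour classes inside a rainbow blow-up *)

Definition good_clique k (V C : finType) (c : {set V} -> C) (S : {set V}) :=
  forall e0, e0 \in pairs V -> e0 \subset S ->
  #|[set e in pairs V | (e \subset S) && (c e == c e0)]| = 1 %[mod k].

Definition rainbow (V C : finType) (c : {set V} -> C) (S : {set V}) :=
  forall e e', e \in pairs V -> e' \in pairs V -> e \subset S -> e' \subset S ->
  c e = c e' -> e = e'.

Lemma rainbow_good k (V C : finType) (c : {set V} -> C) S :
  rainbow c S -> good_clique k c S.
Proof.
move=> inj e0 e0P e0S; rewrite -(cards1 e0); congr (_ %% _); apply: eq_card => e.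
rewrite inE [RHS]inE; apply/idP/eqP => [/and3P[eP eS /eqP]|->].
  exact: inj.
by rewrite e0P e0S eqxx.
Qed.

Lemma rainbow_sub (V C : finType) (c : {set V} -> C) (S S' : {set V}) :
  S' \subset S -> rainbow c S -> rainbow c S'.
Proof.
move=> sub inj e e' eP eP' eS eS'; apply: inj => //; exact: subset_trans sub.
Qed.

(** Each pair [(i, j)], read as the choice of [j] for [i], forbids at most one
choice for one other index. A random choice function is spoilt by a given pair
with probability at most [1 / L ^ 2], and there are [q * L < L ^ 2] pairs. *)
Lemma avoiding_choice q L (t : 'I_q -> 'I_L -> 'I_q * 'I_L) :
    q < L -> (forall i j, (t i j).1 != i) ->
  exists f : {ffun 'I_q -> 'I_L}, forall i, f (t i (f i)).1 != (t i (f i)).2.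
Proof.
move=> qL ti.
pose bad (u : 'I_q * 'I_L) := [set f : {ffun 'I_q -> 'I_L} |
  (f u.1 == u.2) && (f (t u.1 u.2).1 == (t u.1 u.2).2)].
have card_bad u : #|bad u| * L ^ 2 <= L ^ q.
  case: u => i j; pose i' := (t i j).1.
  pose g (v : {ffun 'I_q -> 'I_L} * ('I_L * 'I_L)) := [ffun x =>
    if x == i then v.2.1 else if x == i' then v.2.2 else v.1 x].
  have g_inj : {in setX (bad (i, j)) [set: 'I_L * 'I_L] &, injective g}.
    move=> [f [a b]] [f' [a' b']]; rewrite !inE /= !andbT -/i'.
    move=> /andP[/eqP fi /eqP fi'] /andP[/eqP f'i /eqP f'i'] /ffunP E.
    have := E i; have := E i'; rewrite !ffunE /= !eqxx (negPf (ti i j)) => -> ->.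
    congr (_, _); apply/ffunP => x.
    have [->|xi] := eqVneq x i; first by rewrite fi f'i.
    have [->|xi'] := eqVneq x i'; first by rewrite fi' f'i'.
    by have := E x; rewrite !ffunE /= (negPf xi) (negPf xi').
  have := max_card (mem (g @: setX (bad (i, j)) [set: 'I_L * 'I_L])).
  rewrite card_in_imset // cardsX cardsT card_prod card_ffun !card_ord.
  by rewrite mulnn.
case: (boolP [exists f : {ffun 'I_q -> 'I_L}, [forall i,
    f (t i (f i)).1 != (t i (f i)).2]]).
  by case/existsP => f /forallP; exists f.
rewrite negb_exists => /forallP all_bad.
have : #|{ffun 'I_q -> 'I_L}| <= #|\bigcup_u bad u|.
  apply/subset_leq_card/subsetP => f _.
  have := all_bad f; rewrite negb_forall => /existsP[i]; rewrite negbK => fi.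
  by apply/bigcupP; exists (i, f i); rewrite // inE eqxx.
rewrite card_ffun !card_ord => /leq_trans/(_ (card_bigcup_le _)) le_sum.
have : L ^ q * L ^ 2 <= q * L * L ^ q.
  apply: leq_trans (_ : (\sum_u #|bad u|) * L ^ 2 <= _).
    by rewrite leq_mul2r le_sum orbT.
  have -> : q * L = #|{: 'I_q * 'I_L}| by rewrite card_prod !card_ord.
  by rewrite big_distrl /= -sum_nat_const; apply: leq_sum.
rewrite [leqRHS]mulnC leq_pmul2l; last by rewrite expn_gt0; lia.
by rewrite -mulnn leq_pmul2r; lia.
Qed.

(** The only edge of [E] that could join the colour class of the monochromatic
clique is the one edge [e0] of [E] with colour [c0]; the additional vertices are
chosen outside [e0]. *)
Lemma extend_monochromatic k (V C : finType) (c : {set V} -> C)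
    (E : {set {set V}}) q t P i (A : {set V}) c0 s :
    E \subset pairs V -> {in E &, injective c} ->
    blowup (adj E) [set: V] q t P -> 2 < t -> i < q -> s < q ->
    A \subset P i -> monochromatic c A c0 -> 'C(#|A|, 2) = 1 %[mod k] ->
  exists2 S : {set V}, #|S| = #|A| + s & good_clique k c S.
Proof.
move=> EP cE bl t2 iq sq AP monoA Ak.
pose e0 := odflt set0 [pick e in E | c e == c0].
have e0P e : e \in E -> c e = c0 -> e = e0.
  move=> eE ec; rewrite /e0; case: pickP => [e1 /andP[e1E /eqP e1c]|/(_ e)].
    by apply: cE => //; rewrite ec.
  by rewrite /= eE ec eqxx.
have card_e0 : #|e0| <= 2.
  rewrite /e0; case: pickP => [e1 /andP[/(subsetP EP)+ _]|_]; last by rewrite cards0.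
  by rewrite inE => /eqP->.
have far j : exists x, j < q -> x \in P j :\: e0.
  have [jq|] := ltnP j q; last first.
    have /card_gt0P[x _] : 0 < #|P i| by rewrite (bl.1 i iq).2; lia.
    by exists x.
  have /card_gt0P[x xP] : 0 < #|P j :\: e0|.
    rewrite cardsD (bl.1 j jq).2 subn_gt0 (leq_ltn_trans _ t2) //.
    by rewrite (leq_trans _ card_e0) // subset_leq_card // subsetIr.
  by exists x.
have [x xP] := boolp.choice far.
have bump_lt (j : 'I_s) : bump i j < q.
  by have := ltn_ord j; rewrite /bump; case: (i <= j); lia.
have xbP (j : 'I_s) : x (bump i j) \in P (bump i j) /\ x (bump i j) \notin e0.
  by have := xP _ (bump_lt j); rewrite inE => /andP[].
pose X := [set x (bump i j) | j : 'I_s]; pose S := A :|: X.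
have XE y z : y \in X -> z \in S -> y != z ->
    [set y; z] \in E /\ c [set y; z] != c0.
  case/imsetP => j _ -> zS yz.
  have jE : [set x (bump i j); z] \in E.
    case/setUP: zS yz => [/(subsetP AP) zP _|/imsetP[j' _ ->] yz].
      apply: (blowup_adj_neq EP bl _ iq _ (xbP j).1 zP).2; rewrite //.
      by rewrite eq_sym neq_bump.
    apply: (blowup_adj_neq EP bl _ _ _ (xbP j).1 (xbP j').1).2 => //.
    by apply: contraNneq yz => ->.
  split=> //; apply/eqP => /(e0P _ jE) e0E.
  by have := (xbP j).2; rewrite -e0E !inE eqxx.
have cross e : e \in pairs V -> e \subset S -> ~~ (e \subset A) ->
    e \in E /\ c e != c0.
  case/pairsP => y [z [yz ->]]; rewrite !subUset !sub1set => /andP[yS zS].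
  rewrite negb_and => /orP[yA|zA].
    by apply: XE => //; case/setUP: yS => // ?; case/negP: yA.
  rewrite setUC; apply: XE; rewrite // 1?eq_sym //.
  by case/setUP: zS => // ?; case/negP: zA.
exists S.
  rewrite cardsU disjoint_setI0 ?cards0 ?subn0; last first.
    apply/pred0P => y /=; apply/negP => /andP[/(subsetP AP) yP /imsetP[j _ yE]].
    have [] := blowup_adj_neq EP bl iq (bump_lt j) (neq_bump _ _) yP (xbP j).1.
    by rewrite yE eqxx.
  congr (_ + _); rewrite card_imset ?card_ord // => j j' xx; apply/val_inj.
  apply: (can_inj (bumpK i)); apply/eqP; apply: contraT => jj.
  have [] := blowup_adj_neq EP bl (bump_lt j) (bump_lt j') jj (xbP j).1 (xbP j').1.
  by rewrite xx eqxx.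
move=> e1 e1P e1S; have [e1A|e1A] := boolP (e1 \subset A).
  rewrite -Ak -cards_draws; congr (_ %% _); apply: eq_card => e; rewrite !inE.
  rewrite (monoA e1) // andbC; apply/andP/andP => [[/andP[eS /eqP ec] eP]|[eA eP]].
    split=> //; apply: contraT => eA.
    by have [] := cross e _ eS eA; rewrite ?inE // ec eqxx.
  by rewrite (subset_trans eA (subsetUl _ _)) (monoA e) ?inE ?eqxx.
have [e1E e1c] := cross e1 e1P e1S e1A.
rewrite -(cards1 e1); congr (_ %% _); apply: eq_card => e.
rewrite inE [RHS]inE; apply/idP/eqP => [/and3P[eP eS /eqP ec]|->].
  have eA : ~~ (e \subset A).
    by apply: contra e1c => eA; rewrite -ec (monoA e).
  by apply: cE; rewrite // (cross e eP eS eA).1.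
by rewrite e1P e1S eqxx.
Qed.

(** In the union of one matching edge from each part, two edges of the same
colour must be a matching edge [f i j] and an edge of [E] between two parts. The
latter is determined by the colour, and one of its ends lies in a part other
than [i], hence on at most one matching edge there: choosing [f i j] forbids at
most one other choice, as in [avoiding_choice]. *)
Lemma rainbow_of_matchings (V C : finType) (c : {set V} -> C)
    (E : {set {set V}}) q L t P (f : 'I_q -> 'I_L -> {set V}) :
    E \subset pairs V -> {in E &, injective c} ->
    blowup (adj E) [set: V] q t P -> 1 < q -> q < L ->
    (forall i j, f i j \in pairs V /\ f i j \subset P i) ->
    (forall i j j', j != j' -> [disjoint f i j & f i j']) ->
    (forall i j i' j', c (f i j) = c (f i' j') -> i = i' /\ j = j') ->
  exists2 S : {set V}, #|S| = 2 * q & rainbow c S.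
Proof.
move=> EP cE bl q1 qL fP f_disj cf.
have f_part i j x : x \in f i j -> x \in P i by move/(subsetP (fP i j).2).
have part_uniq (a b : 'I_q) x : x \in P a -> x \in P b -> a = b.
  move=> xa xb; apply/eqP; apply: contraT => ab.
  by have [] := blowup_adj_neq EP bl (ltn_ord a) (ltn_ord b) ab xa xb; rewrite eqxx.
have f_uniq i j j' x : x \in f i j -> x \in f i j' -> j = j'.
  move=> xj xj'; apply/eqP; apply: contraT => /f_disj/disjointFr/(_ xj).
  by rewrite xj'.
have crossE (a b : 'I_q) j j' x y :
    a != b -> x \in f a j -> y \in f b j' -> [set x; y] \in E.
  move=> ab /f_part xa /f_part yb.
  exact: (blowup_adj_neq EP bl (ltn_ord a) (ltn_ord b) ab xa yb).2.
pose hit (i : 'I_q) (j : 'I_L) (h : 'I_q -> 'I_L) := exists (a b : 'I_q) x y,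
  [/\ a != b, x \in f a (h a), y \in f b (h b) & c [set x; y] = c (f i j)].
have target (u : 'I_q * 'I_L) : exists v : 'I_q * 'I_L,
    v.1 != u.1 /\ forall h, hit u.1 u.2 h -> h v.1 = v.2.
  case: u => i j /=; case: (boolp.EM (exists h, hit i j h)); last first.
    move=> no_hit; have [i' i'i] : exists i' : 'I_q, i' != i.
      have [->|i1] := eqVneq i (Ordinal q1); first by exists (Ordinal (ltnW q1)).
      by exists (Ordinal q1); rewrite eq_sym.
    exists (i', j); split=> // h hit_h; case: no_hit; by exists h.
  case=> h0 [a0 [b0 [x0 [y0 [ab0 x0f y0f c0]]]]].
  (* The ends play symmetric roles, and at most one of them lies in part [i]. *)
  wlog bi : a0 b0 x0 y0 ab0 x0f y0f c0 / b0 != i => [hw|].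
    have [b0i|] := eqVneq b0 i; last exact: hw x0f y0f c0.
    apply: (hw b0 a0 y0 x0); rewrite 1?eq_sym // 1?setUC //.
    by rewrite -b0i eq_sym.
  exists (b0, h0 b0); split=> // h [a [b [x [y [ab xf yf cxy]]]]] /=.
  have E0 := crossE _ _ _ _ _ _ ab0 x0f y0f.
  have E1 := crossE _ _ _ _ _ _ ab xf yf.
  have /setP/(_ y0) : [set x; y] = [set x0; y0] by apply: cE; rewrite ?c0.
  rewrite !inE eqxx orbT => /orP[] /eqP y0E; subst y0.
    have ab' := part_uniq _ _ _ (f_part _ _ _ xf) (f_part _ _ _ y0f); subst a.
    exact: f_uniq y0f.
  have bb' := part_uniq _ _ _ (f_part _ _ _ yf) (f_part _ _ _ y0f); subst b.
  exact: f_uniq y0f.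
have [T HT] := boolp.choice target.
have [i j|h hT] := @avoiding_choice q L (fun i j => T (i, j)) qL.
  exact: (HT (i, j)).1.
have no_hit i : ~ hit i (h i) h.
  by move=> /((HT (i, h i)).2 h) /eqP; apply/negP; apply: hT.
pose S := \bigcup_l f l (h l).
have inS x : x \in S -> exists l, x \in f l (h l).
  by case/bigcupP => l _; exists l.
have cases e : e \in pairs V -> e \subset S ->
    (exists l, e = f l (h l)) \/
    (exists (a b : 'I_q) x y,
      [/\ a != b, x \in f a (h a), y \in f b (h b) & e = [set x; y]]).
  case/pairsP => x [y [xy ->]]; rewrite subUset !sub1set.
  case/andP => /inS[a xa] /inS[b yb]; have [ab|ab] := eqVneq a b; last first.
    by right; exists a, b, x, y.
  subst b; left; exists a; apply/eqP.
  rewrite eqEcard subUset !sub1set xa yb cards2 xy.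
  by have := (fP a (h a)).1; rewrite inE => /eqP->.
exists S.
  rewrite -sum1_card partition_disjoint_bigcup /= => [|a b ab]; last first.
    apply/pred0P => x /=; apply/negP => /andP[xa xb]; case/eqP: ab.
    exact: part_uniq (f_part _ _ _ xa) (f_part _ _ _ xb).
  rewrite (eq_bigr (fun=> 2)) ?sum_nat_const ?card_ord 1?mulnC // => l _.
  by have := (fP l (h l)).1; rewrite sum1_card inE => /eqP.
move=> e e' eP eP' eS eS' cee.
case: (cases e eP eS) (cases e' eP' eS') => [[l el]|[a [b [x [y [ab xa yb exy]]]]]].
  case=> [[l' el']|[a [b [x [y [ab xa yb exy]]]]]].
    by move: cee; rewrite el el' => /cf[-> _].
  by case: (no_hit l); exists a, b, x, y; split; rewrite // -exy -el.
case=> [[l' el']|[a' [b' [x' [y' [ab' xa' yb' exy']]]]]].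
  by case: (no_hit l'); exists a, b, x, y; split; rewrite // -exy -el'.
apply: cE => //; rewrite ?exy ?exy'; first exact: crossE ab xa yb.
exact: crossE ab' xa' yb'.
Qed.

(** Greedy construction of the [q * L] matching edges, the edge of index [s]
being sought in part [s %/ L]: if every edge avoiding the vertices used so far
has a colour already used, then only boundedly many colours are available and
Ramsey's theorem gives a monochromatic clique. *)
Lemma monochromatic_or_matchings q L a :
  exists t0, forall (V C : finType) (c : {set V} -> C) (P : nat -> {set V}),
    (forall i, i < q -> t0 <= #|P i|) ->
    (exists i (A : {set V}) c0,
      [/\ i < q, A \subset P i, #|A| = a & monochromatic c A c0]) \/
    (exists f : 'I_q -> 'I_L -> {set V},
      [/\ forall i j, f i j \in pairs V /\ f i j \subset P i,
          forall i j j', j != j' -> [disjoint f i j & f i j'] &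
          forall i j i' j', c (f i j) = c (f i' j') -> i = i' /\ j = j']).
Proof.
have [R HR] := ramsey (q * L) a; exists (R + 2 * (q * L)) => V C c P Pt.
set mono := (exists _, _).
have step N : N <= q * L -> mono \/ exists f : nat -> {set V}, forall s, s < N ->
    [/\ f s \in pairs V, f s \subset P (s %/ L) &
        forall s', s' < s -> [disjoint f s' & f s] /\ c (f s') != c (f s)].
  elim: N => [|N IH] NqL; first by right; exists (fun=> set0).
  have [|[f Hf]] := IH (ltnW NqL); first by left.
  have Nq : N %/ L < q by rewrite ltn_divLR //; case: L NqL {HR Pt IH Hf}; lia.
  pose used := \bigcup_(s < N) f s.
  have card_used : #|used| <= 2 * (q * L).
    apply: leq_trans (card_bigcup_le _) _.
    rewrite (eq_bigr (fun=> 2)) => [|s _].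
      by rewrite sum_nat_const card_ord mulnC leq_mul2l ltnW.
    by have [+ _ _] := Hf s (ltn_ord s); rewrite inE => /eqP.
  pose X := P (N %/ L) :\: used; pose F := [set c (f s) | s : 'I_N].
  have FqL : #|F| <= q * L.
    by apply: leq_trans (leq_imset_card _ _) _; rewrite card_ord ltnW.
  have RX : R <= #|X|.
    have := cardsID used (P (N %/ L)); rewrite -/X; have := Pt _ Nq.
    have := subset_leq_card (subsetIr (P (N %/ L)) used); lia.
  case: (boolP [forall e in pairs V, (e \subset X) ==> (c e \in F)]).
    move/forall_inP => XF; left.
    have [|c0 [A [AX Aa monoA]]] := HR V C c X F FqL _ RX.
      by move=> e eP eX; apply: (implyP (XF e eP)).
    exists (N %/ L), A, c0; split=> //.
    by apply: subset_trans AX _; apply: subsetDl.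
  rewrite negb_forall_in => /exists_inP[e eP]; rewrite negb_imply => /andP[eX ecF].
  right; exists (fun s => if s == N then e else f s) => s.
  rewrite ltnS leq_eqVlt; have [->|sN] /= := eqVneq s N.
    move=> _; split=> //.
      by apply: subset_trans eX _; apply: subsetDl.
    move=> s' s'N; rewrite (ltn_eqF s'N); split.
      apply/pred0P => x /=; apply/negP => /andP[xs' /(subsetP eX)].
      rewrite inE => /andP[/negP[]]; apply/bigcupP.
      by exists (Ordinal s'N).
    by apply: contraNneq ecF => <-; apply/imsetP; exists (Ordinal s'N).
  move=> lt_sN; have [? ? Hs] := Hf s lt_sN; split=> // s' s's.
  by rewrite ltn_eqF ?(ltn_trans s's) //; apply: Hs.
case: (step (q * L) (leqnn _)) => [|[f Hf]]; first by left.
right; exists (fun i j => f (i * L + j)).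
have ltqL (i : 'I_q) (j : 'I_L) : i * L + j < q * L.
  apply: (@leq_trans (i.+1 * L)); last by rewrite leq_mul2r ltn_ord orbT.
  by rewrite mulSn addnC ltn_add2r.
have divL (i : 'I_q) (j : 'I_L) : (i * L + j) %/ L = i.
  have Lgt0 : 0 < L by apply: leq_ltn_trans (ltn_ord j).
  by rewrite divnMDl // divn_small ?addn0.
split=> [i j|i j j' jj|i j i' j' cff].
- by have [? +  _] := Hf _ (ltqL i j); rewrite divL.
- wlog lt_jj : j j' jj / j < j' => [hw|].
    have [|] := ltnP j j'; first exact: hw.
    rewrite leq_eqVlt eq_sym val_eqE (negPf jj) /= disjoint_sym => /hw.
    by apply; rewrite eq_sym.
  have [_ _ /(_ (i * L + j))] := Hf _ (ltqL i j').
  by rewrite ltn_add2l => /(_ lt_jj)[].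
have eq_idx : i * L + j = i' * L + j'.
  case: (ltngtP (i * L + j) (i' * L + j')) => // lt_idx.
    have [_ _ /(_ _ lt_idx)[_]] := Hf _ (ltqL i' j').
    by rewrite cff eqxx.
  have [_ _ /(_ _ lt_idx)[_]] := Hf _ (ltqL i j).
  by rewrite cff eqxx.
have ii : i = i' by apply/val_inj; rewrite /= -(divL i j) eq_idx divL.
split=> //; apply/val_inj; move: eq_idx; rewrite ii => /eqP.
by rewrite eqn_add2l => /eqP.
Qed.

Lemma good_clique_in_blowup k q d p :
    1 < q -> 0 < d -> d <= q -> 2 <= p -> p <= 2 * q ->
    (forall m, 'C(2 + m * d, 2) = 1 %[mod k]) ->
  exists2 t, 0 < t & forall (V C : finType) (c : {set V} -> C)
      (E : {set {set V}}) P,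
    E \subset pairs V -> {in E &, injective c} ->
    blowup (adj E) [set: V] q t P ->
    exists2 S : {set V}, #|S| = p & good_clique k c S.
Proof.
move=> q1 d_gt0 dq p2 pq binE.
pose a := 2 + (p - 2) %/ d * d.
(* The size [q.+1] of the matchings is what [avoiding_choice] asks for; parts of
   size at least [3] have vertices outside any given edge. *)
have [t0 Ht0] := monochromatic_or_matchings q q.+1 a.
exists (t0 + 3) => [|V C c E P EP cE bl]; first by rewrite addn3.
have [i iq||] := Ht0 V C c P.
- by rewrite (bl.1 i iq).2 leq_addr.
- case=> i [A [c0 [iq AP Aa monoA]]].
  have t2 : 2 < t0 + 3 by rewrite addn3.
  have sq : (p - 2) %% d < q by rewrite (leq_trans _ dq) // ltn_mod.
  have Ak : 'C(#|A|, 2) = 1 %[mod k] by rewrite Aa; exact: binE.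
  have [S Sa Sgood] := extend_monochromatic EP cE bl t2 iq sq AP monoA Ak.
  exists S => //; rewrite Sa Aa /a -addnA -divn_eq; lia.
case=> f [fP f_disj cf].
have [S Sq S_rb] := rainbow_of_matchings EP cE bl q1 (ltnSn q) fP f_disj cf.
have [S' S'S S'p] : exists2 S' : {set V}, S' \subset S & #|S'| = p.
  by apply: exists_subset_card; rewrite Sq.
exists S' => //; apply: rainbow_good; exact: rainbow_sub S_rb.
Qed.

(** With [x = m * d], twice the binomial coefficient is [2 + x * (3 + x)];
halving [x * (3 + x)] keeps divisibility by [k] when [k] is odd, and costs the
factor [2] of the period otherwise. *)
Lemma bin2_period k m : 'C(2 + m * (if odd k then k else 2 * k), 2) = 1 %[mod k].
Proof.
set d := if _ then _ else _; pose x := m * d.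
have bin2E : 2 * 'C(2 + x, 2) = (2 + x) * (1 + x).
  by rewrite -mul_bin_diag bin1.
suff [y yE] : exists y, x * (3 + x) = 2 * (y * k).
  have -> : 'C(2 + x, 2) = y * k + 1 by lia.
  by rewrite modnMDl.
rewrite /x /d; case: ifP => k_odd; last by exists (m * (3 + m * (2 * k))); lia.
have dvd2 : 2 %| x * (3 + x) by rewrite dvdn2 oddM oddD /=; case: (odd x).
have : k %| (x * (3 + x)) %/ 2.
  have : k %| 2 * ((x * (3 + x)) %/ 2).
    by rewrite mulnC divnK // /x /d k_odd -mulnA dvdn_mull // dvdn_mulr.
  by rewrite Gauss_dvdr // coprimen2.
case/dvdnP=> y yE; exists y; rewrite -yE [2 * _]mulnC divnK //.
by rewrite /x /d k_odd.
Qed.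

(** * Copies of complete graphs and their colour classes *)

Lemma copy_edges_complete p n (phi : 'I_p -> 'I_n) : injective phi ->
  copy_edges (complete_graph p) phi =
  [set e in pairs 'I_n | e \subset phi @: [set: 'I_p]].
Proof.
move=> phi_inj; apply/setP => e; rewrite inE; apply/imsetP/andP.
  case=> e' /pairsP[x [y [xy ->]]] ->; rewrite imsetU1 imset_set1 in_pairs2.
  by rewrite (inj_eq phi_inj) subUset !sub1set !imset_f.
case=> /pairsP[x [y [xy ->]]]; rewrite subUset !sub1set.
case/andP => /imsetP[x' _ xE] /imsetP[y' _ yE]; subst x y.
exists [set x'; y']; last by rewrite imsetU1 imset_set1.
by rewrite in_pairs2; apply: contraNneq xy => ->.
Qed.

Lemma nb_edges_spanned (V : finType) (E : {set {set V}}) (sE : E \subset pairs V) :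
  nb_edges (spanned sE) = #|E|.
Proof.
rewrite /nb_edges -(card_imset _ (imset_inj val_inj)); apply: eq_card => e.
apply/imsetP/idP => [[e']|eE]; first by rewrite inE => ? ->.
have eV : val @: [set x : {x | x \in cover E} | val x \in e] = e.
  apply/setP => x; apply/imsetP/idP => [[x']|xe]; first by rewrite inE => ? ->.
  have xE : x \in cover E by apply/bigcupP; exists e.
  by exists (Sub x xE); rewrite ?inE.
by exists [set x : {x | x \in cover E} | val x \in e]; rewrite ?inE eV.
Qed.

Lemma f_number_le n (V : finType) (G : sgraph V) F m :
  forces n G F m -> f_number n G F <= m.
Proof.
by move=> fm; rewrite /f_number; case: ex_minnP => f _; apply; apply/boolp.asboolP.
Qed.

Lemma f_number_forces n (V : finType) (G : sgraph V) F :
  forces n G F (f_number n G F).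
Proof. by rewrite /f_number; case: ex_minnP => f /boolp.asboolP. Qed.

Lemma color_representatives (T C : finType) (c : T -> C) (D : {set T}) :
  exists E : {set T}, [/\ E \subset D, {in E &, injective c} & #|E| = #|c @: D|].
Proof.
pose rep e := [pick e' in D | c e' == c e].
pose E := [set e in D | rep e == Some e].
have E_inj : {in E &, injective c}.
  move=> e e'; rewrite !inE => /andP[_ /eqP Ee] /andP[_ /eqP Ee'] cee.
  by apply: Some_inj; rewrite -Ee -Ee' /rep cee.
exists E; split=> //; first by apply/subsetP => e; rewrite inE => /andP[].
rewrite -(card_in_imset E_inj); apply: eq_card => i.
apply/imsetP/imsetP => -[e]; first by rewrite inE => /andP[eD _] ->; exists e.
move=> eD ->; have : isSome (rep e).
  by rewrite /rep; case: pickP => // /(_ e); rewrite /= eD eqxx.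
case rep_e: (rep e) => [e'|] // _.
have /andP[e'D /eqP ce'] : (e' \in D) && (c e' == c e).
  by move: rep_e; rewrite /rep; case: pickP => // e'' + [<-].
by exists e'; rewrite ?inE ?e'D //= /rep ce' -/(rep e) rep_e.
Qed.

(** * Upper bounds from rainbow blow-ups *)

Lemma forces_of_good_clique n k p m :
    (forall (C : finType) (c : {set 'I_n} -> C), m <= nb_colors c ->
      exists2 S : {set 'I_n}, #|S| = p & good_clique k c S) ->
  forces n (complete_graph p) (family_mod1 k) m.
Proof.
move=> clique C c mc; have [S Sp Sgood] := clique C c mc.
pose phi (i : 'I_p) := enum_val (cast_ord (esym Sp) i).
have phi_inj : injective phi by move=> i j /enum_val_inj/cast_ord_inj.
have phiS : phi @: [set: 'I_p] = S.
  apply/eqP; rewrite eqEcard card_imset // cardsT card_ord Sp leqnn andbT.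
  by apply/subsetP => _ /imsetP[i _ ->]; apply: enum_valP.
exists phi, phi_inj => i /imsetP[e0].
rewrite copy_edges_complete // phiS inE => /andP[e0P e0S] ->.
rewrite /= /mod1_mem nb_edges_spanned -(Sgood e0 e0P e0S); congr (_ %% _).
by apply: eq_card => e; rewrite inE copy_edges_complete // phiS !inE andbA.
Qed.

Lemma period_le k p : 1 < k ->
    (if odd k then 2 * k - 1 <= p else 4 * k - 1 <= p) ->
  let d := if odd k then k else 2 * k in [/\ 0 < d, d <= uphalf p & 4 < p].
Proof.
move=> k1; rewrite uphalf_half; have := odd_double_half p.
case: ifP => k_odd /= pE pk; split; move: pk; rewrite -{1}pE; try lia.
Qed.

(** This is [2 r f / n ^ 2 <= r - 1 + 1 / M.+1 + o(1)] cleared of denominators.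
The colours are counted one below the least forcing number; the lost colour
accounts for the [2 * r] added to the constant of [erdos_stone_edges]. *)
Lemma f_number_upper k p M : 1 < k ->
    (if odd k then 2 * k - 1 <= p else 4 * k - 1 <= p) ->
  let r := (uphalf p).-1 in
  exists K, forall n,
    M.+1 * (2 * r * f_number n (complete_graph p) (family_mod1 k)) + M * n ^ 2
      <= M.+1 * (r * (n ^ 2 + n) + K).
Proof.
move=> k1 /(period_le k1); set d := if _ then _ else _ => -[d_gt0 dq p4] r.
have q1 : 1 < uphalf p by rewrite uphalf_half; lia.
have qE : r.+1 = uphalf p by rewrite /r prednK // ltnW.
have pq : p <= 2 * uphalf p by rewrite uphalf_half; lia.
have [t t_gt0 Ht] := good_clique_in_blowup q1 d_gt0 dq (ltnW (ltnW (ltnW p4))) pq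
  (bin2_period k).
have [K HK] := erdos_stone_edges r M t_gt0.
exists (K + 2 * r) => n; set f := f_number _ _ _.
have forces_ineq m :
    M.+1 * (r * (n ^ 2 + n) + K) <= M * n ^ 2 + M.+1 * (2 * r * m) ->
    f <= m.
  move=> ineq; apply: f_number_le; apply: forces_of_good_clique => C c mc.
  have [E [EP E_inj E_card]] := color_representatives c (pairs 'I_n).
  have [|P bl] := HK _ E EP.
    rewrite card_ord (leq_trans ineq) // leq_add2l !leq_mul2l E_card.
    by rewrite mc !orbT.
  by move: bl; rewrite qE => bl; apply: Ht EP E_inj bl.
have r_gt0 : 0 < r by rewrite -ltnS qE.
case fE: f => [|m]; first by nia.
have : ~ M.+1 * (r * (n ^ 2 + n) + K) <= M * n ^ 2 + M.+1 * (2 * r * m).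
  by move/forces_ineq; rewrite fE ltnn.
move/negP; rewrite -ltnNge; lia.
Qed.

Lemma turan_upper q M : 1 < q ->
  let r := q.-1 in
  exists K, forall n,
    M.+1 * (2 * r * turan_number n (complete_graph q)) + M * n ^ 2
      <= M.+1 * (r * (n ^ 2 + n) + K).
Proof.
move=> q1 r; have qE : r.+1 = q by rewrite /r prednK // ltnW.
have [K HK] := erdos_stone_edges r M (ltn0Sn 0).
exists K => n; rewrite /turan_number.
have r_gt0 : 0 < r by rewrite -ltnS qE.
apply: (big_ind (fun m => M.+1 * (2 * r * m) + M * n ^ 2
      <= M.+1 * (r * (n ^ 2 + n) + K))); first by nia.
  by move=> x y; case: (leqP x y).
move=> [E EP]; apply: contraR; rewrite -ltnNge => lt.
have [|P bl] := HK _ E EP.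
  by move: lt; rewrite card_ord /nb_edges /=; lia.
rewrite qE in bl.
have part (i : 'I_q) : exists x, x \in P i.
  by apply/card_gt0P; rewrite (bl.1 i (ltn_ord i)).2.
have [x xP] := boolp.choice part.
have x_edge (i j : 'I_q) : i != j -> x i != x j /\ [set x i; x j] \in E.
  by move=> ij; apply: blowup_adj_neq EP bl (ltn_ord i) (ltn_ord j) ij (xP i) (xP j).
apply/existsP; exists (finfun x); apply/andP; split.
  apply/injectiveP => i j; rewrite !ffunE => xij; apply/eqP; apply: contraT.
  by case/x_edge; rewrite xij eqxx.
apply/forall_inP => e /pairsP[i [j [ij ->]]].
by rewrite imsetU1 imset_set1 !ffunE (x_edge i j ij).2.
Qed.

(** * Lower bounds from complete multipartite graphs *)

Definition residue_edges n r : {set {set 'I_n}} :=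
  [set e in pairs 'I_n | [exists x in e, [exists y in e, x != y %[mod r]]]].

Lemma in_residue_edges n r (x y : 'I_n) :
  ([set x; y] \in residue_edges n r) = (x != y %[mod r]).
Proof.
rewrite inE in_pairs2; apply/andP/idP => [[xy /exists_inP[a + /exists_inP[b]]]|ne].
  by rewrite !inE => /pred2P[->|->] /pred2P[->|->]; rewrite ?eqxx // eq_sym.
split; first by apply: contraNneq ne => ->.
by apply/exists_inP; exists x; rewrite ?inE ?eqxx //; apply/exists_inP; exists y;
   rewrite ?inE ?eqxx ?orbT.
Qed.

Lemma residue_edges_pairs n r : residue_edges n r \subset pairs 'I_n.
Proof. by apply/subsetP => e; rewrite inE => /andP[]. Qed.

Lemma card_residue_class n r (v : 'I_n) : 0 < r ->
  #|[set w : 'I_n | w == v %[mod r]]| <= (n %/ r).+1.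
Proof.
move=> r_gt0; have lt (w : 'I_n) : w %/ r < (n %/ r).+1.
  by rewrite ltnS leq_div2r // ltnW.
rewrite -[leqRHS]card_ord -(card_in_imset (f := fun w => Ordinal (lt w))).
  exact: max_card.
move=> w w'; rewrite !inE => /eqP wv /eqP wv' /(congr1 val) /= div_eq.
by apply/val_inj; rewrite /= (divn_eq w r) (divn_eq w' r) div_eq wv wv'.
Qed.

Lemma card_residue_edges n r : 0 < r ->
  r * n ^ 2 <= n ^ 2 + r * n + 2 * r * #|residue_edges n r|.
Proof.
move=> r_gt0; have := sum_nonnbr_adj (residue_edges_pairs n r).
rewrite card_ord => sumE.
have : r * \sum_v nonnbr (adj (residue_edges n r)) setT v <= n * (n + r).
  apply: (@leq_trans (\sum_(v : 'I_n) (n + r))); last first.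
    by rewrite sum_nat_const card_ord.
  rewrite big_distrr; apply: leq_sum => v _.
  rewrite (leq_trans (n := r * (n %/ r).+1)) //.
    rewrite leq_mul2l (leq_trans _ (card_residue_class v r_gt0)) ?orbT //.
    apply/subset_leq_card/subsetP => w.
    by rewrite !inE /adj in_residue_edges negbK eq_sym.
  by rewrite mulnS addnC leq_add2r mulnC leq_trunc_div.
move: sumE; move: (\sum_v _) => s; rewrite -!mulnn; nia.
Qed.

Lemma turan_lower n q : 1 < q ->
  #|residue_edges n q.-1| <= turan_number n (complete_graph q).
Proof.
move=> q1; have r_gt0 : 0 < q.-1 by case: q q1 => [|[]].
pose H := SGraph (residue_edges_pairs n q.-1).
suff free : ~~ contains H (complete_graph q).
  exact: (leq_bigmax_cond (F := fun H : sgraph 'I_n => nb_edges H) H free).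
apply/negP => /existsP[f /andP[/injectiveP f_inj /forall_inP fE]].
pose h (i : 'I_q) : 'I_q.-1 := Ordinal (ltn_pmod (f i) r_gt0).
have [|s _] := @pigeonhole _ _ [set: 'I_q] [set: 'I_q.-1] h 1 (fun i _ => in_setT _).
  by rewrite !cardsT !card_ord muln1; lia.
case/card_gt1P => i [j []]; rewrite !inE => /eqP hi /eqP hj ij.
have /fE : [set i; j] \in edges (complete_graph q) by rewrite in_pairs2.
rewrite imsetU1 imset_set1 in_residue_edges => /negP; apply.
by apply/eqP/(congr1 val (etrans hi (esym hj))).
Qed.

Definition top n (e : {set 'I_n}) := [set x in e | [forall y in e, y <= x]].

Lemma top2 n (x y : 'I_n) : x < y -> top [set x; y] = [set y].
Proof.
move=> xy; apply/setP => z; rewrite !inE; apply/andP/eqP => [[/pred2P[->|->//]]|->].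
  by move/forall_inP/(_ y); rewrite !inE eqxx orbT => /(_ isT); rewrite leqNgt xy.
split; first by rewrite eqxx orbT.
by apply/forall_inP => w; rewrite !inE => /pred2P[]->; rewrite // ltnW.
Qed.

(** Colours are sets of vertices, so that one type holds both kinds: two-element
sets for the edges between residue classes, singletons for those inside a class.
*)
Definition residue_coloring n r (e : {set 'I_n}) :=
  if e \in residue_edges n r then e else top e.

Lemma nb_colors_residue n r :
  #|residue_edges n r| <= nb_colors (residue_coloring (n := n) r).
Proof.
apply/subset_leq_card/subsetP => e eT; apply/imsetP; exists e.
  exact: (subsetP (residue_edges_pairs n r)).
by rewrite /residue_coloring eT.
Qed.

Lemma three_smallest n (S : {set 'I_n}) : 2 < #|S| ->
  exists x y z : 'I_n, [/\ [/\ x \in S, y \in S & z \in S], x < y, y < z &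
    forall u, u \in S -> u < z -> u = x \/ u = y].
Proof.
have min (A : {set 'I_n}) : 0 < #|A| -> exists2 x, x \in A &
    forall u, u \in A :\ x -> x < u.
  case/card_gt0P => a aA; case: (arg_minnP (P := mem A) val aA) => x xA xmin.
  exists x => // u; rewrite !inE => /andP[ux uA]; rewrite ltn_neqAle xmin // andbT.
  by rewrite eq_sym.
move=> S3; have [|x xS xmin] := min S; first exact: ltn_trans S3.
have S2 : 1 < #|S :\ x| by move: S3; rewrite (cardsD1 x) xS.
have [|y yS ymin] := min (S :\ x); first exact: ltn_trans S2.
have S1 : 0 < #|S :\ x :\ y| by move: S2; rewrite (cardsD1 y) yS.
have [//|z zS zmin] := min (S :\ x :\ y).
have [zS' yS'] : z \in S /\ y \in S.
  by move: zS yS; rewrite !inE => /and3P[_ _ ->] /andP[_ ->].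
exists x, y, z; split=> //; [exact: xmin | exact: ymin |] => u uS uz.
have [|ux] := eqVneq u x; first by left.
have [|uy] := eqVneq u y; first by right.
have [uz'|uz'] := eqVneq u z; first by rewrite uz' ltnn in uz.
by have := zmin u; rewrite !inE uz' uy ux uS => /(_ isT); lia.
Qed.

Lemma f_number_lower n k p r : 1 < k -> 0 < r -> 2 * r < p ->
  #|residue_edges n r| <= f_number n (complete_graph p) (family_mod1 k).
Proof.
move=> k1 r_gt0 rp; rewrite leqNgt; apply/negP => f_lt.
have [] := @f_number_forces n _ (complete_graph p) (family_mod1 k) _
  (residue_coloring r) (leq_trans (ltnW f_lt) (nb_colors_residue n r)).
move=> phi [phi_inj good]; pose X := phi @: [set: 'I_p].
pose h (x : 'I_n) : 'I_r := Ordinal (ltn_pmod x r_gt0).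
have [||s _] := @pigeonhole _ _ X [set: 'I_r] h 2.
- by move=> *; rewrite inE.
- by rewrite card_imset // !cardsT !card_ord mulnC.
case/three_smallest => x [y [z [[xS yS zS] xy yz below]]].
have S_in u : u \in [set x in X | h x == s] -> u \in X /\ u = s %[mod r].
  by rewrite inE => /andP[-> /eqP <-]; rewrite /= modn_mod.
have [xX xs] := S_in x xS; have [yX ys] := S_in y yS; have [zX zs] := S_in z zS.
have color2 (u v : 'I_n) : u < v -> u = v %[mod r] ->
    residue_coloring r [set u; v] = [set v].
  move=> uv uvr; rewrite /residue_coloring in_residue_edges uvr eqxx /=.
  exact: top2.
have copyE (u v : 'I_n) : u \in X -> v \in X -> u < v ->
    [set u; v] \in copy_edges (complete_graph p) phi.
  move=> uX vX uv; rewrite copy_edges_complete // inE in_pairs2 subUset.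
  by rewrite !sub1set uX vX !andbT neq_ltn uv.
have xz : x < z by apply: ltn_trans yz.
have classE : class_edges (complete_graph p) phi (residue_coloring r) [set z]
    = [set [set x; z]; [set y; z]].
  apply/setP => e; rewrite [LHS]inE [RHS]inE !in_set1; apply/andP/orP; last first.
    by case=> /eqP->; rewrite copyE ?color2 ?xs ?ys ?zs.
  case; rewrite copy_edges_complete // inE => /andP[/pairsP[u [v [uv ->]]]].
  rewrite subUset !sub1set => /andP[uX vX].
  wlog {uv} uv : u v uX vX / u < v => [hw|].
    move: uv; rewrite neq_ltn => /orP[|vu]; first exact: hw.
    by rewrite setUC; apply: hw.
  rewrite /residue_coloring in_residue_edges.
  case: (eqVneq (u %% r) (v %% r)) => [uvr /=|_ /= /eqP uvz]; last first.
    by have := cards1 z; rewrite -uvz cards2 neq_ltn uv.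
  rewrite top2 // => /eqP/set1_inj vz; subst v.
  have [|->|->] := below u _ uv; [|by left|by right].
  by rewrite inE uX; apply/eqP/val_inj; rewrite /= uvr zs modn_small.
have zC : [set z] \in residue_coloring r @: copy_edges (complete_graph p) phi.
  by apply/imsetP; exists [set x; z]; rewrite ?copyE ?color2 ?xs ?zs.
have := good _ zC; rewrite /= /mod1_mem nb_edges_spanned classE cards2.
have -> : [set x; z] != [set y; z].
  apply/eqP => /setP/(_ x); rewrite !inE eqxx /= => /esym/pred2P[] xE.
    by rewrite xE ltnn in xy.
  by rewrite xE ltnn in xz.
by case: k k1 {good f_lt} => [|[|[|k]]] // _; rewrite !modn_small.
Qed.

(** * The limit of the quotient *)

Import Order.TTheory GRing.Theory Num.Theory.
Import numFieldNormedType.Exports.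
Local Open Scope classical_set_scope.
Local Open Scope ring_scope.

(** The two bounds squeeze the quotient between [r - 1 - r / n] and
[r - 1 + 1 / M.+1 + (r + K) / n], for every [M]. *)
Lemma turan_density_cvg (R : realType) (r : nat) (u : nat -> nat) :
    (forall n, r * n ^ 2 <= n ^ 2 + r * n + 2 * r * u n)%N ->
    (forall M, exists K, forall n,
      M.+1 * (2 * r * u n) + M * n ^ 2 <= M.+1 * (r * (n ^ 2 + n) + K))%N ->
  (2 * r * u n)%:R / (n ^ 2)%:R @[n --> \oo] --> (r%:R - 1 : R).
Proof.
move=> lower upper; apply/cvgrPdist_le => eps eps_gt0.
have eps2 : 0 < eps / 2 by lra.
(* [1 / M.+1] and [(r + K) / n] are each made smaller than [eps / 2]. *)
pose M := Num.truncn ((eps / 2)^-1); have [K HK] := upper M.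
have M_large : 1 <= M.+1%:R * (eps / 2).
  by rewrite -ler_pdivrMr // mul1r ltW // truncnS_gt.
pose N := Num.truncn ((r + K)%:R / (eps / 2)).
near=> n.
have nN : (r + K)%:R <= n%:R * (eps / 2) :> R.
  rewrite -ler_pdivrMr // ltW // (lt_le_trans (truncnS_gt _)) // ler_nat.
  by near: n; exact: nbhs_infty_ge.
have n1 : 1 <= n%:R :> R by rewrite ler1n; near: n; exact: nbhs_infty_ge.
move: (lower n) (HK n); move: (2 * r * u n)%N => y lo up.
have {}lo : r%:R * n%:R ^+ 2 <= n%:R ^+ 2 + r%:R * n%:R + y%:R :> R.
  by move: lo; rewrite -(ler_nat R) !(natrD, natrM, natrX).
have {}up : M.+1%:R * y%:R + (M.+1%:R - 1) * n%:R ^+ 2 <=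
    M.+1%:R * (r%:R * (n%:R ^+ 2 + n%:R) + K%:R) :> R.
  by move: up; rewrite -(ler_nat R) !(natrD, natrM, natrX) -[M.+1%:R]natr1 addrK.
rewrite natrX; move: n1 nN lo up M_large; rewrite natrD.
have := ler0n R K; have := ler0n R r; have := ltr0Sn R M.
move: n%:R r%:R K%:R y%:R M.+1%:R => n' r' K' y' m.
move=> m_gt0 r_ge0 K_ge0 n1 nN lo up M_large.
have n_gt0 : 0 < n' by lra.
have -> : r' - 1 - y' / n' ^+ 2 = ((r' - 1) * n' ^+ 2 - y') / n' ^+ 2.
  by field; rewrite gt_eqF.
rewrite ler_norml ler_pdivlMr ?exprn_gt0 // ler_pdivrMr ?exprn_gt0 //.
have rK : (r' + K') * n' <= eps / 2 * n' ^+ 2 by rewrite expr2; nra.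
have Kn : K' <= K' * n' by nra.
apply/andP; split; last by nra.
suff : m * (y' - (r' - 1) * n' ^+ 2) <= m * (eps * n' ^+ 2).
  by rewrite ler_pM2l //; lra.
have : n' ^+ 2 <= m * (eps / 2) * n' ^+ 2 by rewrite ler_peMl // exprn_ge0 // ltW.
have : m * (r' * n' + K') <= m * (eps / 2 * n' ^+ 2) by rewrite ler_pM2l //; lra.
lra.
Unshelve. all: by end_near.
Qed.

Theorem theorem7p2 (R : realType) (k p : nat) :
  (2 <= k)%N ->
  (if odd k then 2 * k - 1 <= p else 4 * k - 1 <= p)%N ->
  exists2 eps : nat -> R,
    eps n @[n --> \oo] --> (0 : R)
    & forall n : nat, (p <= n)%N ->
        (f_number n (complete_graph p) (family_mod1 k))%:R =
        (1 + eps n) * (turan_number n (complete_graph (uphalf p)))%:R.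
Proof.
move=> k2 pk; have [_ _ p4] := period_le k2 pk.
have q2 : (2 < uphalf p)%N by rewrite uphalf_half; lia.
set r := (uphalf p).-1.
have r2 : (1 < r)%N by rewrite /r; lia.
have rp : (2 * r < p)%N by rewrite /r uphalf_half; lia.
pose f n := f_number n (complete_graph p) (family_mod1 k).
pose x n := turan_number n (complete_graph (uphalf p)).
have lower n m : (#|residue_edges n r| <= m)%N ->
    (r * n ^ 2 <= n ^ 2 + r * n + 2 * r * m)%N.
  move=> Tm; apply: leq_trans (card_residue_edges n (ltnW r2)) _.
  by rewrite leq_add2l leq_mul2l Tm orbT.
have f_lower n := lower n _ (f_number_lower n k2 (ltnW r2) rp).
have x_lower n := lower n _ (turan_lower n (ltnW q2)).
have f_cvg := @turan_density_cvg R _ _ f_lower (fun M => f_number_upper M k2 pk).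
have x_cvg := @turan_density_cvg R _ _ x_lower (fun M => turan_upper M (ltnW q2)).
have x_neq0 n : (p <= n)%N -> (x n)%:R != 0 :> R.
  move=> pn; rewrite pnatr_eq0; apply/negP => /eqP xn0.
  by have := x_lower n; rewrite -/(x n) xn0; nia.
have r1 : r%:R - 1 != 0 :> R by rewrite subr_eq0 pnatr_eq1; lia.
have ratio_cvg : (f n)%:R / (x n)%:R @[n --> \oo] --> (1 : R).
  rewrite -[X in _ --> X](divff r1).
  apply: cvg_trans (cvgM f_cvg (cvgV r1 x_cvg)).
  apply: near_eq_cvg; near=> n.
  have pn : (p <= n)%N by near: n; exact: nbhs_infty_ge.
  rewrite /= -/(f n) -/(x n) -mulnn !natrM; have := x_neq0 n pn.
  have : n%:R != 0 :> R by rewrite pnatr_eq0; lia.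
  have : r%:R != 0 :> R by rewrite pnatr_eq0; lia.
  by move=> r0 n0 x0; field; rewrite x0 n0 r0.
exists (fun n => (f n)%:R / (x n)%:R - 1).
  by rewrite -(subrr 1); apply: cvgB => //; exact: cvg_cst.
by move=> n /x_neq0 x0; rewrite addrC subrK divfK.
Unshelve. all: by end_near.
Qed.
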